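(* Let $\alpha=p/q$ with $p,q$ relatively prime positive integers and $p<q$, and let $\delta>0$ be fixed. Let $(A_{ij})_{i,j\ge0}$ and $(B_{ij})_{i,j\ge0}$ be families of real $N\times N$ matrices, and let $\Xi_{ri}\in\mathbb{R}^N$ be given for all integers $r\ge0$, $i\ge 0$ with $i>r\alpha-1$. Let $X_{rn}\in\mathbb{R}^N$ (for integers $r\ge 0$, $n\ge 0$ with $n>r\alpha-1$) be defined by the recursion $$X_{rn}=\Xi_{rn}+\sum_{r\alpha-1<l\le n-1}\ \sum_{i=0}^{n-l-1}\frac{1}{n-i-r\alpha}A_{i,n-i-l-1}X_{rl}+\chi(r\ge1)\sum_{(r-1)\alpha-1<l\le n-1}\ \sum_{i=0}^{n-l-1}B\big(1-\alpha,\,n-i-(r-1)\alpha\big)B_{i,n-i-l-1}X_{r-1,l}.$$ Define, for $n\ge0$, $$\mathbf{X}_n:=\sum_{r\ge 0:\ r\alpha<n+1}\delta^{-r\alpha}\|X_{rn}\|,\qquad \mathbf{\Xi}_n:=\sum_{r\ge 0:\ r\alpha<n+1}\delta^{-r\alpha}\|\Xi_{rn}\|,$$ and $$L_0:=0,\quad M_0:=0,\quad L_m:=\sum_{i=0}^{m-1}\|A_{i,m-i-1}\|,\quad M_m:=\sum_{i=0}^{m-1}\|B_{i,m-i-1}\|\quad(m\ge1).$$ If each of the sequences $(\mathbf{\Xi}_n)_{n\ge0}$, $(L_n)_{n\ge0}$, $(M_n)_{n\ge0}$ is the sequence of coefficients of a power series with strictly positive radius of convergence, then the power series $\sum_{n=0}^{\infty}t^n\mathbf{X}_n$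 has a strictly positive radius of convergence.
   Context: $\|\cdot\|$ denotes a fixed vector norm on $\mathbb{R}^N$ and also the induced matrix norm on $N\times N$ matrices. $B(\mu,\nu)=\Gamma(\mu)\Gamma(\nu)/\Gamma(\mu+\nu)$ for $\mu,\nu>0$ is the beta function (written with two real arguments), unrelated to the matrices $B_{ij}$ (written with subscripts). $\chi(P)=1$ if the statement $P$ is true and $0$ otherwise; when $r=0$ the last term of the recursion is absent. Summation indices are integers, and sums over empty index sets are $0$. The recursion arises from substituting $x(t)=\sum_{r\ge 0}\sum_{i>r\alpha-1}t^{i-r\alpha}X_{ri}$, and a similar expansion of $\xi$ with coefficients $\Xi_{ri}$, into the Abel-type Volterra system $x(t)=\xi(t)+\int_0^t\big(a(t,s)+(t-s)^{-\alpha}b(t,s)\big)x(s)\,ds$, where $a(t,s)=\sum_{i,j} t^is^jA_{ij}$ and $b(t,s)=\sum_{i,j} t^is^jB_{ij}$. *)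

(* Defs.v *)
From HB Require Import structures.
From mathcomp Require Import all_boot all_order all_algebra.
From mathcomp Require Import all_classical all_reals all_analysis.
Set Implicit Arguments.
Unset Strict Implicit.
Unset Printing Implicit Defensive.
Import Order.TTheory GRing.Theory Num.Theory.
Import numFieldNormedType.Exports.
Local Open Scope classical_set_scope.
Local Open Scope ring_scope.

(* An arbitrary vector norm; the canonical norm of the library on matrices is
   the entrywise maximum, which is only one instance. *)
Record is_vector_norm (R : realType) (N : nat) (nrm : 'cV[R]_N -> R) : Prop :=
  IsVectorNorm {
    vnorm_triangle : forall x y, nrm (x + y) <= nrm x + nrm y ;
    vnorm_homog : forall (a : R) x, nrm (a *: x) = `|a| * nrm x ;
    vnorm_definite : forall x, nrm x = 0 -> x = 0 }.

Definition induced_norm (R : realType) (N : nat) (nrm : 'cV[R]_N -> R)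
    (A : 'M[R]_N) : R :=
  sup [set nrm (A *m x) | x in [set x | nrm x <= 1]].

Definition Gamma (R : realType) (x : R) : R :=
  \int[lebesgue_measure]_(t in `]0, +oo[) (t `^ (x - 1) * expR (- t)).

Definition Beta (R : realType) (mu nu : R) : R :=
  Gamma mu * Gamma nu / Gamma (mu + nu).

(* Least upper bound of the |t| at which the power series with coefficients a
   converges. *)
Definition conv_radius (R : realType) (a : R^nat) : \bar R :=
  ereal_sup [set `|t|%:E | t in [set t | cvgn (pseries a t)]].

(* The families Xi and X are only meaningful at the pairs (r, n) with
   r alpha - 1 < n; the recursion is imposed, and refers to X, only there.
   The indices l of the sums satisfy l > -1, hence range over nat, and all the
   natural number subtractions below are exact. *)
Definition satisfies_recursion (R : realType) (N : nat) (alpha : R)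
    (A B : nat -> nat -> 'M[R]_N) (Xi X : nat -> nat -> 'cV[R]_N) : Prop :=
  forall r n : nat, r%:R * alpha - 1 < n%:R ->
    X r n = Xi r n
      + \sum_(0 <= l < n | r%:R * alpha - 1 < l%:R)
          \sum_(0 <= i < n - l)
            (n%:R - i%:R - r%:R * alpha)^-1 *: (A i (n - i - l - 1)%N *m X r l)
      + (if r is s.+1 then
           \sum_(0 <= l < n | s%:R * alpha - 1 < l%:R)
             \sum_(0 <= i < n - l)
               Beta (1 - alpha) (n%:R - i%:R - s%:R * alpha)
                 *: (B i (n - i - l - 1)%N *m X s l)
         else 0).

(* The sum over all r with r alpha < n + 1, where alpha = p / q; when p > 0
   such an r satisfies r < (n + 1) q, so the upper bound loses no term. *)
Definition weighted_norm_sum (R : realType) (N : nat) (nrm : 'cV[R]_N -> R)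
    (p q : nat) (delta : R) (X : nat -> nat -> 'cV[R]_N) (n : nat) : R :=
  let alpha := p%:R / q%:R in
  \sum_(0 <= r < n.+1 * q | r%:R * alpha < n%:R + 1)
    delta `^ (- (r%:R * alpha)) * nrm (X r n).

Definition antidiagonal_norm_sum (R : realType) (N : nat)
    (nrm : 'cV[R]_N -> R) (A : nat -> nat -> 'M[R]_N) (m : nat) : R :=
  \sum_(0 <= i < m) induced_norm nrm (A i (m - i - 1)%N).

(* Main.v *)
(** All the arguments [n - i - r alpha] occurring in the recursion are positive
    multiples of [1/q].  Hence the coefficients [1 / (n - i - r alpha)] are at
    most [q], and the Beta coefficients are bounded as well: the functional
    equation of Gamma gives [Beta mu (nu + 1) <= Beta mu nu], so only the
    arguments [1/q, ..., q/q] matter.  Multiplying the recursion by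
    [delta ^ (- r alpha)] and summing over [r] then yields a scalar convolution
    inequality [x_n <= xi_n + K * sum_(l < n) (L_(n-l) + M_(n-l)) * x_l], and if
    [xi_n] and [K * (L_n + M_n)] are at most [C * rho ^ n], induction gives
    [x_n <= C * (rho * (1 + C)) ^ n]. *)
Require Import Defs.
From HB Require Import structures.
From mathcomp Require Import all_boot all_order all_algebra.
From mathcomp Require Import all_classical all_reals all_analysis.
From mathcomp Require Import measurable_realfun.
From mathcomp Require Import ring lra zify.
Import Order.TTheory GRing.Theory Num.Theory.
Import numFieldNormedType.Exports.
Local Open Scope classical_set_scope.
Local Open Scope ring_scope.

(** * The functional equation of Gamma *)

Lemma continuous_powRl (R : realType) (x t : R) : 0 < t ->
  {for t, continuous (fun u : R => u `^ x)}.
Proof.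
move=> t0; apply: differentiable_continuous; apply/derivable1_diffP.
by apply: derivable_powR; rewrite in_itv/= t0.
Qed.

(** One term of the exponential series, t^(k+1) / (k+1)! <= e^t, already gives decay of order 1/t.
    This disposes of the boundary term at infinity. *)
Lemma powR_expRN_le (R : realType) (x : R) (k : nat) (t : R) :
  x <= k%:R -> 1 <= t -> t `^ x * expR (- t) <= k.+1`!%:R / t.
Proof.
move=> xk t1; have t0 : 0 < t by lra.
rewrite expRN ler_pdivrMr ?expR_gt0// mulrAC ler_pdivlMr//.
have h1 : t `^ x <= t ^+ k by rewrite -powR_mulrn ?ler_powR// ltW.
have h2 : t ^+ k.+1 <= k.+1`!%:R * expR t.
  have := expR_ge1Dxn k (ltW t0).
  rewrite -ler_pdivrMl ?ltr0n ?fact_gt0// mulrC; lra.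
by apply: le_trans h2; rewrite exprSr ler_wpM2r// ltW.
Qed.

Lemma cvg_invr_natSS (R : realType) : (n.+2%:R^-1 : R) @[n --> \oo] --> 0.
Proof.
by have := @cvg_harmonic R; rewrite -(cvg_shiftS (@harmonic R : nat -> R^o)).
Qed.

Lemma Gamma_boundary_cvg (R : realType) (x : R) : 0 < x ->
  (fun n => n.+2%:R `^ x * expR (- n.+2%:R) : R) @ \oo --> 0.
Proof.
move=> x0.
have [k xk] : exists k : nat, x <= k%:R.
  by exists (Num.truncn x).+1; apply/ltW/truncnS_gt.
apply: (@squeeze_cvgr _ _ _ _ (fun=> 0) (fun n => k.+1`!%:R * n.+2%:R^-1)).
- near=> n; apply/andP; split; first by rewrite mulr_ge0 ?powR_ge0 ?expR_ge0.
  by apply: powR_expRN_le => //; rewrite ler1n.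
- exact: cvg_cst.
- rewrite -[X in _ --> X](mulr0 k.+1`!%:R); apply: cvgM; first exact: cvg_cst.
  exact: cvg_invr_natSS.
Unshelve. all: by end_near. Qed.
Lemma derivable_oo_LRcontinuous_cc (R : realType) (f : R -> R) (a b : R) :
  (forall t, t \in `[a, b] -> derivable f t 1) -> a < b ->
  derivable_oo_LRcontinuous f a b.
Proof.
move=> df ab.
have cf t : t \in `[a, b] -> {for t, continuous f}.
  by move=> tab; exact/differentiable_continuous/derivable1_diffP/df.
split.
- by move=> t tab; apply: df; exact: subset_itv_oo_cc.
- by apply/cvg_at_right_filter/cf; rewrite in_itv/= lexx ltW.
- by apply/cvg_at_left_filter/cf; rewrite in_itv/= lexx ltW.
Qed.

Lemma integral_powR_expRN_by_parts (R : realType) (x a b : R) :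
  0 <= x -> 0 < a < b ->
  (\int[lebesgue_measure]_(t in `[a, b]) (t `^ x * expR (- t))%:E =
   (a `^ x * expR (- a) - b `^ x * expR (- b))%:E +
   \int[lebesgue_measure]_(t in `[a, b]) (x * (t `^ (x - 1) * expR (- t)))%:E)%E.
Proof.
move=> x0 /andP[a0 ab].
have pos t : t \in `[a, b] -> 0 < t.
  by rewrite in_itv/= => /andP[at_ _]; exact: lt_le_trans at_.
have dexp (t : R) : is_derive t 1 (fun u : R => - expR (- u)) (expR (- t)).
  have := is_deriveN (is_derive1_comp (is_derive_expR (- t)) (is_deriveNid t 1)).
  by rewrite mulrN1 opprK.
have cexp : continuous (fun u : R => expR (- u)).
  by move=> t; apply: continuous_comp; [exact: continuousN|exact: continuous_expR].
rewrite (@integration_by_parts R (fun t => t `^ x) (fun t => - expR (- t))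
  (fun t => x * t `^ (x - 1)) (fun t => expR (- t)) a b ab).
- congr (_ + _)%E; first by congr EFin; ring.
  (* The sign leaves the integral by nonnegativity of the integrand, without integrability; this
     uses [0 <= x]. *)
  under eq_integral do rewrite mulrN EFinN -mulrA.
  rewrite integral_ge0N ?oppeK//= => t _.
  by rewrite lee_fin !mulr_ge0 ?powR_ge0 ?expR_ge0.
- apply: continuous_in_subspaceT => t; rewrite inE => /pos t0.
  by apply: cvgM; [exact: cvg_cst|exact: continuous_powRl].
- apply: derivable_oo_LRcontinuous_cc => // t /pos t0.
  by apply: derivable_powR; rewrite in_itv/= t0.
- by move=> t tab; rewrite powR_derive1// in_itv/= pos//; exact: subset_itv_oo_cc tab.
- by apply: continuous_subspaceT => t.
- by apply: derivable_oo_LRcontinuous_cc => // t _; exact: ex_derive.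
- by move=> t _; rewrite derive1E; exact: derive_val.
Qed.
(** The exhaustion used for monotone convergence. The shift by 2 ensures 1/(n+2) < 1 < n+2, so every
    interval is nondegenerate and integration by parts applies on it. *)
Lemma itv0y_bigcup_cc (R : realType) :
  `]0, +oo[%classic = \bigcup_n `[(n.+2%:R : R)^-1, n.+2%:R]%classic.
Proof.
apply/seteqP; split => [t/=|t [n _]/=]; rewrite !in_itv/= ?andbT.
- move=> t0; pose n := (Num.truncn t + Num.truncn t^-1)%N.
  exists n => //=; rewrite in_itv/= invf_ple ?posrE//.
  by apply/andP; split; apply/ltW/(lt_le_trans (truncnS_gt _));
    rewrite ler_nat ltnS ?leqW ?leq_addr ?leq_addl.
- by case/andP => + _; apply: lt_le_trans; rewrite invr_gt0.
Qed.

Lemma measurable_powR_expRN (R : realType) (x : R) (D : set R) : measurable D ->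
  measurable_fun D (EFin \o (fun t => t `^ x * expR (- t))).
Proof.
move=> mD; apply/measurable_EFinP; apply: measurable_funM.
- apply: measurable_funTS; exact: measurable_powR.
- apply: measurable_funTS; apply: (measurableT_comp (@measurable_expR R)).
  exact: oppr_measurable.
Qed.

Lemma integral_powR_expRN_cvg (R : realType) (x : R) :
  (\int[lebesgue_measure]_(t in `[n.+2%:R^-1%R, n.+2%:R%R]) (t `^ x * expR (- t))%:E)%E
   @[n --> \oo] -->
  (\int[lebesgue_measure]_(t in `]0%R, +oo[) (t `^ x * expR (- t))%:E)%E.
Proof.
rewrite itv0y_bigcup_cc; apply: ge0_nondecreasing_set_cvg_integral => //.
- apply/nondecreasing_seqP => n; apply/subsetPset => t/=.
  rewrite !in_itv/= => /andP[tl tu]; apply/andP; split.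
    by apply: le_trans tl; rewrite lef_pV2 ?posrE// ler_nat.
  by apply: (le_trans tu); rewrite ler_nat.
- by move=> n; exact: measurable_powR_expRN.
- by move=> n t _; rewrite lee_fin mulr_ge0 ?powR_ge0 ?expR_ge0.
Qed.

(* The limit of the integrations by parts is taken in the extended reals, so that
   the finiteness of the integrals is not needed. *)
Lemma Gamma_addr1 (R : realType) (x : R) : 0 < x ->
  Gamma (x + 1) = x * Gamma x.
Proof.
move=> x0; rewrite /Gamma addrK /Rintegral.
set I1 := (X in fine X); set I0 := (X in x * fine X).
suff -> : I1 = (x%:E * I0)%E.
  (* [fine] sends infinite values to 0. Since [x > 0], an infinite [I0] makes [x%:E * I0] infinite
     as well, and both sides become 0. *)
  case: I0 => [r//| |]; rewrite ?gt0_muley ?gt0_muleNy ?lte_fin//= ?mulr0//.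
pose a n : R := n.+2%:R^-1.
have a_gt0 n : 0 < a n by rewrite invr_gt0.
have a0 : a n @[n --> \oo] --> 0 by exact: cvg_invr_natSS.
pose b n := a n `^ x * expR (- a n) - n.+2%:R `^ x * expR (- n.+2%:R).
have b0 : (b n)%:E @[n --> \oo] --> 0%:E.
  apply: cvg_EFin; first by near=> n.
  rewrite -[X in _ --> X](subr0 0) -[X in X - _](mul0r (expR (- 0))).
  apply: cvgB; last exact: Gamma_boundary_cvg.
  apply: cvgM.
    by move/cvg_at_rightP : (powR_cvg0 x0); apply.
  apply: continuous_cvg; first exact: continuous_expR.
  exact: cvgN.
have I1E n : (\int[lebesgue_measure]_(t in `[a n, n.+2%:R]) (t `^ x * expR (- t))%:E =
    (b n)%:E + x%:E *
    \int[lebesgue_measure]_(t in `[a n, n.+2%:R]) (t `^ (x - 1) * expR (- t))%:E)%E.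
  rewrite integral_powR_expRN_by_parts ?ltW//; last first.
    by rewrite a_gt0/= (@lt_trans _ _ 1)// ?ltr1n// invf_lt1 ?ltr1n.
  congr (_ + _)%E; rewrite -ge0_integralZl//.
  - exact: measurable_powR_expRN.
  - by move=> t _; rewrite lee_fin mulr_ge0 ?powR_ge0 ?expR_ge0.
  - by rewrite lee_fin ltW.
have cvgI1 := @integral_powR_expRN_cvg R x.
rewrite (funext I1E) in cvgI1.
have cvgI0 : ((b n)%:E + x%:E *
    \int[lebesgue_measure]_(t in `[a n, n.+2%:R]) (t `^ (x - 1) * expR (- t))%:E)%E
   @[n --> \oo] --> (x%:E * I0)%E.
  rewrite -[X in _ --> X]add0e; apply: cvgeD => //.
  by apply: cvgeZl => //; exact: integral_powR_expRN_cvg.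
exact: (cvg_unique _ cvgI1 cvgI0).
Unshelve. all: by end_near. Qed.

(** * Uniform bounds on Beta values *)

Lemma Gamma_ge0 (R : realType) (x : R) : 0 <= Gamma x.
Proof.
by apply: Rintegral_ge0 => t _; rewrite mulr_ge0 ?powR_ge0 ?expR_ge0.
Qed.

Lemma Beta_ge0 (R : realType) (mu nu : R) : 0 <= Beta mu nu.
Proof. by rewrite /Beta divr_ge0 ?mulr_ge0 ?Gamma_ge0. Qed.

Lemma Beta_addr1 (R : realType) (mu nu : R) : 0 < mu -> 0 < nu ->
  Beta mu (nu + 1) = nu / (mu + nu) * Beta mu nu.
Proof.
move=> mu0 nu0; rewrite /Beta addrA !Gamma_addr1 ?addr_gt0//.
by rewrite invfM; ring.
Qed.

Lemma Beta_addr1_le (R : realType) (mu nu : R) : 0 < mu -> 0 < nu ->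
  Beta mu (nu + 1) <= Beta mu nu.
Proof.
move=> mu0 nu0; rewrite Beta_addr1// ler_piMl ?Beta_ge0//.
by rewrite ler_pdivrMr ?addr_gt0// mul1r lerDr ltW.
Qed.

Lemma Beta_frac_bounded (R : realType) (mu : R) (q : nat) : 0 < mu -> (0 < q)%N ->
  exists2 C, 0 <= C & forall k : nat, (0 < k)%N -> Beta mu (k%:R / q%:R) <= C.
Proof.
move=> mu0 q0; have qn0 : q%:R != 0 :> R by rewrite pnatr_eq0 -lt0n.
(* All terms being nonnegative, the sum over one period of base values serves in place of their
   maximum. *)
exists (\sum_(1 <= j < q.+1) Beta mu (j%:R / q%:R)).
  by apply: sumr_ge0 => j _; exact: Beta_ge0.
elim/ltn_ind => k IH k0; have [kq|qk] := leqP k q.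
  rewrite (bigD1_seq k) ?iota_uniq ?mem_index_iota ?k0//= lerDl.
  by apply: sumr_ge0 => j _; exact: Beta_ge0.
(* Subtracting [q] from [k] lowers the second argument of Beta by exactly 1. *)
rewrite -(subnK (ltnW qk)) natrD mulrDl divff//.
apply: (@le_trans _ _ (Beta mu ((k - q)%:R / q%:R))).
  by apply: Beta_addr1_le => //; rewrite divr_gt0 ?ltr0n ?subn_gt0.
by apply: IH; rewrite ?subn_gt0// ltn_subrL q0 k0.
Qed.

(** * Arbitrary vector norms and the induced matrix norm *)

Section VectorNorm.
Variables (R : realType) (N : nat) (nrm : 'cV[R]_N -> R).
Hypothesis hnrm : is_vector_norm nrm.

Lemma vnorm0 : nrm 0 = 0.
Proof. by rewrite -(scale0r 0) (vnorm_homog hnrm) normr0 mul0r. Qed.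

Lemma vnormN (x : 'cV[R]_N) : nrm (- x) = nrm x.
Proof. by rewrite -scaleN1r (vnorm_homog hnrm) normrN1 mul1r. Qed.

Lemma vnorm_ge0 (x : 'cV[R]_N) : 0 <= nrm x.
Proof.
by have := vnorm_triangle hnrm x (- x); rewrite subrr vnorm0 vnormN; lra.
Qed.

Lemma vnorm_sum (I : Type) (s : seq I) (P : pred I) (F : I -> 'cV[R]_N) :
  nrm (\sum_(i <- s | P i) F i) <= \sum_(i <- s | P i) nrm (F i).
Proof.
elim/big_ind2 : _ => [|x a y b xa yb|//]; first by rewrite vnorm0.
by apply: le_trans (vnorm_triangle hnrm a b) _; rewrite lerD.
Qed.

(** Expand [y] in the standard basis and bound each coordinate by the max norm. Row vectors are used
    to fit the extreme value theorem [EVT_min_rV] applied below. *)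
Lemma vnorm_mulmx_le (A : 'M[R]_N) (y : 'rV[R]_N) :
  nrm (A *m y^T) <= (\sum_i nrm (A *m delta_mx i 0)) * `|y|.
Proof.
have -> : A *m y^T = \sum_i y 0 i *: (A *m delta_mx i 0).
  rewrite {1}[y]row_sum_delta linear_sum/= mulmx_sumr; apply: eq_bigr => i _.
  by rewrite linearZ/= trmx_delta scalemxAr.
rewrite mulr_suml; apply: le_trans (vnorm_sum _ _ _ _) _.
apply: ler_sum => i _; rewrite (vnorm_homog hnrm) mulrC.
rewrite ler_wpM2l ?vnorm_ge0// [leRHS]/Num.norm/= mx_normrE.
by rewrite (@le_bigmax _ _ _ _ (fun ij => `|y ij.1 ij.2|) (0, i)).
Qed.

Lemma vnorm_tr_continuous : continuous (fun y : 'rV[R]_N => nrm y^T).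
Proof.
pose C := \sum_i nrm (1%:M *m delta_mx i 0).
have C0 : 0 <= C by apply: sumr_ge0 => i _; exact: vnorm_ge0.
have lip (y z : 'rV[R]_N) : `|nrm y^T - nrm z^T| <= C * `|y - z|.
  have := vnorm_mulmx_le 1%:M (y - z); rewrite mul1mx -/C => yz.
  apply: le_trans yz.
  rewrite linearB/=.
  have := vnorm_triangle hnrm (y^T - z^T) z^T.
  have := vnorm_triangle hnrm (z^T - y^T) y^T.
  rewrite -[z^T - y^T]opprB vnormN opprB !subrK ler_norml => ? ?.
  by apply/andP; split; lra.
move=> y; apply/(@cvgrPdist_lt _ _ _ _ (nbhs_filter y)) => e e0.
(* [C] may vanish, hence the divisor [C + 1]. *)
have e1 : 0 < e / (C + 1) by rewrite divr_gt0// ltr_wpDl.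
near=> z; apply: le_lt_trans (lip _ _) _.
apply: (@le_lt_trans _ _ ((C + 1) * `|y - z|)).
  by rewrite ler_wpM2r// lerDl.
rewrite -ltr_pdivlMl ?ltr_wpDl// mulrC; near: z.
exact: cvgr_dist_lt.
Unshelve. all: by end_near. Qed.

(** On the compact unit sphere of the max norm, [nrm] attains a minimum, which is positive by
    definiteness; homogeneity extends the bound to all vectors. *)
Lemma mx_norm_le_vnorm :
  exists2 c, 0 < c & forall y : 'rV[R]_N, c * `|y| <= nrm y^T.
Proof.
pose S := [set y : 'rV[R]_N | `|y| = 1].
have SP y : y != 0 -> S (`|y|^-1 *: y).
  move=> y0; rewrite /S/= normrZ normfV normr_id mulVf// normr_eq0//.
have [[y0 Sy0]|noS] := pselect (S !=set0); last first.
  (* An empty sphere means that 0 is the only vector, so any constant works. *)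
  exists 1 => // y; have [->|yn0] := eqVneq y 0.
    by rewrite normr0 mulr0 vnorm_ge0.
  by exfalso; apply: noS; exists (`|y|^-1 *: y); exact: SP.
have cS : compact S.
  apply: bounded_closed_compact.
    by exists 1; split => // M M1 y /= ->; exact: ltW.
  rewrite (_ : S = (fun y : 'rV[R]_N => `|y|) @^-1` [set 1])//.
  by apply: closed_comp => [y _|]; [exact: norm_continuous|exact: closed_eq].
have [c /[!inE] Sc cmin] := EVT_min_rV (ex_intro _ _ Sy0) cS
  (continuous_subspaceT vnorm_tr_continuous).
have c0 : 0 < nrm c^T.
  rewrite lt_neqAle vnorm_ge0 andbT eq_sym; apply/eqP => /(vnorm_definite hnrm).
  move/(congr1 trmx); rewrite trmxK trmx0 => c0.
  by move: Sc; rewrite /S/= c0 normr0 => /esym/eqP; rewrite oner_eq0.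
exists (nrm c^T) => // y; have [->|yn0] := eqVneq y 0.
  by rewrite normr0 mulr0 vnorm_ge0.
have := cmin (`|y|^-1 *: y); rewrite inE => /(_ (SP _ yn0)).
rewrite linearZ/= (vnorm_homog hnrm) normfV normr_id mulrC ler_pdivlMr//.
by rewrite normr_gt0.
Qed.

(** Guarantees that the [sup] in [induced_norm] is a genuine supremum rather than a default value:
    [nrm x <= 1] bounds the max norm of [x] by [c^-1]. *)
Lemma induced_norm_has_ubound (A : 'M[R]_N) :
  has_ubound [set nrm (A *m x) | x in [set x | nrm x <= 1]].
Proof.
have [c c0 cP] := mx_norm_le_vnorm.
exists ((\sum_i nrm (A *m delta_mx i 0)) * c^-1) => _ [y /= y1 <-].
rewrite -[y]trmxK; apply: le_trans (vnorm_mulmx_le _ _) _.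
apply: ler_wpM2l; first by apply: sumr_ge0 => i _; exact: vnorm_ge0.
rewrite -[leRHS]mul1r ler_pdivlMr// mulrC.
by apply: le_trans (cP _) _; rewrite trmxK.
Qed.

Lemma induced_norm_ge0 (A : 'M[R]_N) : 0 <= induced_norm nrm A.
Proof.
apply: ub_le_sup; first exact: induced_norm_has_ubound.
by exists 0; rewrite /= ?mulmx0 vnorm0.
Qed.

Lemma le_induced_norm (A : 'M[R]_N) (x : 'cV[R]_N) :
  nrm (A *m x) <= induced_norm nrm A * nrm x.
Proof.
have [x0|x0] := eqVneq (nrm x) 0.
  by rewrite (vnorm_definite hnrm x0) mulmx0 vnorm0 mulr0.
have {}x0 : 0 < nrm x by rewrite lt_neqAle eq_sym x0 vnorm_ge0.
rewrite -ler_pdivrMr//.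
have -> : nrm (A *m x) / nrm x = nrm (A *m ((nrm x)^-1 *: x)).
  by rewrite -scalemxAr (vnorm_homog hnrm) normfV (gtr0_norm x0) mulrC.
apply: ub_le_sup; first exact: induced_norm_has_ubound.
exists ((nrm x)^-1 *: x) => //=.
by rewrite (vnorm_homog hnrm) normfV gtr0_norm// mulVf// gt_eqF.
Qed.

Lemma antidiagonal_norm_sum_ge0 (A : nat -> nat -> 'M[R]_N) (m : nat) :
  0 <= antidiagonal_norm_sum nrm A m.
Proof. by apply: sumr_ge0 => i _; exact: induced_norm_ge0. Qed.

(** The pairs [(i, n - i - l - 1)] run over the antidiagonal that makes up the norm sum of index
    [n - l], so a uniform bound on the scalars suffices. It serves both kernels of the recursion. *)
Lemma vnorm_antidiagonal_le (A : nat -> nat -> 'M[R]_N) (x : 'cV[R]_N)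
    (c : R^nat) (K : R) (n l : nat) :
  (forall i, (i < n - l)%N -> 0 <= c i <= K) ->
  nrm (\sum_(0 <= i < n - l) c i *: (A i (n - i - l - 1)%N *m x))
    <= K * antidiagonal_norm_sum nrm A (n - l) * nrm x.
Proof.
move=> cK; rewrite /antidiagonal_norm_sum mulr_sumr mulr_suml.
apply: le_trans (vnorm_sum _ _ _ _) _.
apply: ler_sum_nat => i /andP[_ inl]; have /andP[c0 cK_] := cK i inl.
rewrite (vnorm_homog hnrm) ger0_norm// -mulrA.
have -> : (n - i - l - 1 = n - l - i - 1)%N by lia.
apply: ler_pM => //; [exact: vnorm_ge0|exact: le_induced_norm].
Qed.
End VectorNorm.

(** * Radius of convergence, geometric bounds and the scalar inequality *)

(** Convergence at some [t != 0] makes the terms [a n * t ^+ n] bounded, so the inverse of the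
    absolute value of [t] is an admissible rate. *)
Lemma geometric_bound_of_radius (R : realType) (a : R^nat) :
  (0 < conv_radius a)%E ->
  exists C rho : R, [/\ 0 <= C, 0 < rho & forall n, a n <= C * rho ^+ n].
Proof.
move=> /ereal_sup_gt[_ [t /= cvt <-]]; rewrite lte_fin => t0.
have [M [_ /(_ (`|M| + 1)) aM]] := cvg_series_bounded cvt.
exists (`|M| + 1), `|t|^-1; split; [by rewrite addr_ge0| by rewrite invr_gt0|] => n.
have {}aM : `|a n * t ^+ n| <= `|M| + 1.
  by apply: aM => //; rewrite (le_lt_trans (ler_norm M))// ltrDl.
apply: le_trans (ler_norm _) _.
by rewrite exprVn ler_pdivlMr ?exprn_gt0// -normrX -normrM.
Qed.

(** At [t = (2 * rho)^-1] the series is dominated by a geometric one of ratio 1/2. *)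
Lemma radius_gt0_of_geometric_bound (R : realType) (a : R^nat) (C rho : R) :
  0 < rho -> (forall n, 0 <= a n) -> (forall n, a n <= C * rho ^+ n) ->
  (0 < conv_radius a)%E.
Proof.
move=> rho0 a0 aC; pose t := (2 * rho)^-1.
have t0 : 0 < t by rewrite invr_gt0 mulr_gt0.
apply: (@lt_le_trans _ _ `|t|%:E); first by rewrite lte_fin normr_gt0 gt_eqF.
apply: ereal_sup_ubound; exists t => //=.
apply: (@series_le_cvg _ _ (geometric C 2^-1)).
- by move=> n; rewrite mulr_ge0// exprn_ge0// ltW.
- move=> n; rewrite /= mulr_ge0 ?exprn_ge0//.
  by have := le_trans (a0 0%N) (aC 0%N); rewrite expr0 mulr1.
- move=> n /=; have -> : 2^-1 = rho * t by rewrite /t; field; rewrite gt_eqF.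
  by rewrite exprMn mulrA ler_wpM2r// exprn_ge0// ltW.
- by apply: is_cvg_geometric_series; rewrite ger0_norm//; lra.
Qed.

(** The rate [rho * (1 + C)] is chosen so that the induction closes with equality: after factoring
    out [C * rho ^+ n], what remains is 1 + C * sum_(l < n) (1 + C)^l = (1 + C)^n. *)
Lemma discrete_gronwall (R : realType) (x xi k : R^nat) (C rho : R) :
  0 <= C -> 0 < rho -> (forall n, 0 <= x n) ->
  (forall n, xi n <= C * rho ^+ n) -> (forall n, k n <= C * rho ^+ n) ->
  (forall n, x n <= xi n + \sum_(0 <= l < n) k (n - l)%N * x l) ->
  forall n, x n <= C * (rho * (1 + C)) ^+ n.
Proof.
move=> C0 rho0 x0 xiC kC xk; elim/ltn_ind => n IH.
apply: le_trans (xk n) _.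
apply: (@le_trans _ _ (C * rho ^+ n +
    \sum_(0 <= l < n) C * rho ^+ (n - l) * (C * (rho * (1 + C)) ^+ l))).
  apply: lerD => //; apply: ler_sum_nat => l /andP[_ ln].
  apply: (@le_trans _ _ (C * rho ^+ (n - l) * x l)); first by rewrite ler_wpM2r.
  by rewrite ler_wpM2l ?IH// mulr_ge0// exprn_ge0// ltW.
rewrite (eq_big_nat _ _ (F2 := fun l => C * rho ^+ n * C * (1 + C) ^+ l)).
  rewrite -mulr_sumr exprMn big_mkord.
  have -> : (1 + C) ^+ n = 1 + C * \sum_(i < n) (1 + C) ^+ i.
    by have := subrX1 (1 + C) n; rewrite [1 + C - 1]addrC addrA addNr add0r; lra.
  by rewrite le_eqVlt; apply/orP; left; apply/eqP; ring.
move=> l /andP[_ ln]; rewrite exprMn -[in RHS](subnK (ltnW ln)) exprD; ring.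
Qed.

(** * From the vector recursion to a scalar convolution inequality *)

Section Weighted.
Variables (R : realType) (N : nat) (nrm : 'cV[R]_N -> R).
Hypothesis hnrm : is_vector_norm nrm.
Variables (p q : nat).
Hypotheses (hp : (0 < p)%N) (hpq : (p < q)%N).
Variable delta : R.
Let alpha : R := p%:R / q%:R.
Let w (r : nat) : R := delta `^ (- (r%:R * alpha)).
Let W := weighted_norm_sum nrm p q delta.

Let q0 : (0 < q)%N.
Proof. exact: leq_ltn_trans hpq. Qed.

Lemma frac_sub1_lt (r n : nat) :
  (r%:R * alpha - 1 < n%:R) = (r * p < n.+1 * q)%N.
Proof.
by rewrite ltrBlDr natr1 /alpha mulrA ltr_pdivrMr ?ltr0n// -!natrM ltr_nat.
Qed.

Lemma weight_ge0 r : 0 <= w r.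
Proof. exact: powR_ge0. Qed.

Lemma weightS r : 0 < delta -> w r.+1 = delta `^ (- alpha) * w r.
Proof.
move=> d0; rewrite /w -powRD; last by rewrite (gt_eqF d0) implybT.
by congr powR; rewrite -natr1; ring.
Qed.

(** Since [0 < p], the filter already forces [r < l.+1 * q], so the range of [r] may be enlarged. A
    common range for all [l] permits exchanging the sums over [r] and [l]. *)
Lemma weighted_norm_sumE (Y : nat -> nat -> 'cV[R]_N) (m l : nat) :
  (l.+1 * q <= m)%N ->
  W Y l = \sum_(0 <= r < m | r%:R * alpha - 1 < l%:R) w r * nrm (Y r l).
Proof.
move=> lm; rewrite /W /weighted_norm_sum (big_nat_widen _ _ _ _ _ lm).
apply: eq_bigl => r; rewrite -ltrBlDr frac_sub1_lt andb_idr// => rl.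
by apply: leq_ltn_trans rl; rewrite leq_pmulr.
Qed.

Lemma weighted_norm_sum_ge0 (Y : nat -> nat -> 'cV[R]_N) (n : nat) : 0 <= W Y n.
Proof.
by apply: sumr_ge0 => r _; rewrite mulr_ge0 ?powR_ge0 ?vnorm_ge0.
Qed.

Lemma weighted_convolution (Y : nat -> nat -> 'cV[R]_N) (k : R^nat) (m n : nat) :
  (n * q <= m)%N ->
  \sum_(0 <= r < m) w r *
    (\sum_(0 <= l < n | r%:R * alpha - 1 < l%:R) k l * nrm (Y r l)) =
  \sum_(0 <= l < n) k l * W Y l.
Proof.
move=> nm.
under eq_bigr do rewrite mulr_sumr big_mkcond/=.
rewrite exchange_big_nat/=; apply: eq_big_nat => l /andP[_ ln].
rewrite (@weighted_norm_sumE _ m); last by rewrite (leq_trans _ nm)// leq_mul2r ln orbT.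
rewrite mulr_sumr [RHS]big_mkcond/=; apply: eq_bigr => r _.
by case: ifP => // _; rewrite mulrCA.
Qed.

(** From [i < n - l] follows r alpha < l + 1 <= n - i, so the numerator (n - i) q - r p is a
    positive integer. *)
Lemma kernel_arg_frac (r l i n : nat) : (i < n - l)%N ->
  r%:R * alpha - 1 < l%:R ->
  exists2 k : nat, (0 < k)%N & n%:R - i%:R - r%:R * alpha = k%:R / q%:R.
Proof.
move=> inl; rewrite frac_sub1_lt => rl.
have rn : (r * p < (n - i) * q)%N.
  by apply: (leq_trans rl); rewrite leq_mul2r; apply/orP; right; lia.
exists ((n - i) * q - r * p)%N; first by rewrite subn_gt0.
rewrite natrB ?(ltnW rn)// !natrM natrB; last by lia.
by rewrite /alpha; field; rewrite pnatr_eq0 -lt0n.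
Qed.

Lemma recursion_vnorm_le (A B : nat -> nat -> 'M[R]_N)
    (Xi X : nat -> nat -> 'cV[R]_N) : satisfies_recursion alpha A B Xi X ->
  exists2 K, 0 <= K & forall r n : nat, r%:R * alpha - 1 < n%:R ->
    nrm (X r n) <= nrm (Xi r n)
    + \sum_(0 <= l < n | r%:R * alpha - 1 < l%:R)
        K * antidiagonal_norm_sum nrm A (n - l) * nrm (X r l)
    + (if r is s.+1 then
         \sum_(0 <= l < n | s%:R * alpha - 1 < l%:R)
           K * antidiagonal_norm_sum nrm B (n - l) * nrm (X s l)
       else 0).
Proof.
move=> hX.
have alpha1 : 0 < 1 - alpha by rewrite subr_gt0 ltr_pdivrMr ?ltr0n// mul1r ltr_nat.
have [C C0 CP] := Beta_frac_bounded _ _ _ alpha1 q0.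
(* [q] bounds the reciprocals in the [A] terms, [C] the Beta values in the [B] terms. *)
exists (q%:R + C) => [|r n rn]; first by rewrite addr_ge0.
rewrite hX//; apply: le_trans (vnorm_triangle hnrm _ _) _; apply: lerD.
  apply: le_trans (vnorm_triangle hnrm _ _) _; apply: lerD => //.
  apply: le_trans (vnorm_sum _ _ _ hnrm _ _ _ _) _.
  apply: ler_sum => l rl; apply: vnorm_antidiagonal_le => // i inl.
  have [k k0 ->] := kernel_arg_frac _ _ _ _ inl rl.
  rewrite invf_div divr_ge0//=; apply: (@le_trans _ _ q%:R); last by rewrite lerDl.
  by rewrite ler_pdivrMr ?ltr0n// ler_peMr// ler1n.
case: r rn => [_|s _]; first by rewrite vnorm0.
apply: le_trans (vnorm_sum _ _ _ hnrm _ _ _ _) _.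
apply: ler_sum => l sl; apply: vnorm_antidiagonal_le => // i inl.
have [k k0 ->] := kernel_arg_frac _ _ _ _ inl sl.
by rewrite Beta_ge0/=; apply: le_trans (CP k k0) _; rewrite lerDr.
Qed.

Lemma weighted_recursion_le (A B : nat -> nat -> 'M[R]_N)
    (Xi X : nat -> nat -> 'cV[R]_N) : 0 < delta ->
  satisfies_recursion alpha A B Xi X ->
  exists2 K, 0 <= K & forall n, W X n <= W Xi n +
    \sum_(0 <= l < n) K * (antidiagonal_norm_sum nrm A (n - l) +
                           antidiagonal_norm_sum nrm B (n - l)) * W X l.
Proof.
move=> d0 /recursion_vnorm_le[K K0 XK].
pose D := delta `^ (- alpha); have D0 : 0 <= D by exact: powR_ge0.
(* The [B] terms link [r] to [r - 1]; the shift of weight costs the factor [D]. *)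
exists (K + D * K) => [|n]; first by rewrite addr_ge0 ?mulr_ge0.
pose a l := K * antidiagonal_norm_sum nrm A (n - l).
pose b l := K * antidiagonal_norm_sum nrm B (n - l).
have a0 l : 0 <= a l by rewrite mulr_ge0 ?antidiagonal_norm_sum_ge0.
have b0 l : 0 <= b l by rewrite mulr_ge0 ?antidiagonal_norm_sum_ge0.
pose S k r := \sum_(0 <= l < n | r%:R * alpha - 1 < l%:R) k l * nrm (X r l).
have S0 k r : (forall l, 0 <= k l) -> 0 <= S k r.
  by move=> k0; apply: sumr_ge0 => l _; rewrite mulr_ge0 ?vnorm_ge0.
pose T r := if r is s.+1 then S b s else 0.
have T0 r : 0 <= T r by case: r => //= s; exact: S0.
(* One value of [r] is lost when the [B] sum is reindexed by [r = s.+1]; the remaining range still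
   covers all [l < n]. *)
have qn : (n * q <= (n.+1 * q).-1)%N by lia.
apply: (@le_trans _ _ (W Xi n + \sum_(0 <= r < n.+1 * q) w r * S a r
                       + \sum_(0 <= r < n.+1 * q) w r * T r)).
  rewrite !(@weighted_norm_sumE _ (n.+1 * q))//.
  (* Nonnegativity allows the filter on [r] to be dropped, which decouples it from [n]. *)
  have drop (F : R^nat) : (forall r, 0 <= F r) ->
      \sum_(0 <= r < n.+1 * q | r%:R * alpha - 1 < n%:R) F r
      <= \sum_(0 <= r < n.+1 * q) F r.
    by move=> F0; rewrite big_mkcond; apply: ler_sum => r _; case: ifP.
  have dropS := drop (fun r => w r * S a r)
    (fun r => mulr_ge0 (weight_ge0 r) (S0 a r a0)).
  have dropT := drop (fun r => w r * T r) (fun r => mulr_ge0 (weight_ge0 r) (T0 r)).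
  apply: le_trans (lerD (lerD (lexx _) dropS) dropT).
  rewrite -!big_split/=. apply: ler_sum => r rn.
  by rewrite -!mulrDr ler_wpM2l ?weight_ge0// XK.
have -> : \sum_(0 <= r < n.+1 * q) w r * T r = \sum_(0 <= l < n) D * b l * W X l.
  rewrite -(prednK (_ : 0 < n.+1 * q)%N) ?muln_gt0//.
  rewrite big_nat_recl//= mulr0 add0r.
  under eq_bigr do rewrite weightS// -mulrA.
  rewrite -mulr_sumr weighted_convolution// mulr_sumr.
  by apply: eq_bigr => l _; rewrite mulrA.
rewrite weighted_convolution ?leq_mul2r ?leqnSn ?orbT//.
rewrite -addrA lerD2l -big_split/=; apply: ler_sum => l _.
rewrite -mulrDl ler_wpM2r ?weighted_norm_sum_ge0// /a /b.
(* These are the cross terms by which [(K + D * K)] times the sum of both norm sums exceeds what is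
   needed. *)
have KB := mulr_ge0 K0 (antidiagonal_norm_sum_ge0 _ _ _ hnrm B (n - l)).
have DKA := mulr_ge0 (mulr_ge0 D0 K0) (antidiagonal_norm_sum_ge0 _ _ _ hnrm A (n - l)).
rewrite mulrDl !mulrDr mulrA; lra.
Qed.
End Weighted.

(** * Positive radius of convergence for the weighted solution *)

Theorem theorem4p1 (R : realType) (N : nat) (hN : (0 < N)%N)
    (nrm : 'cV[R]_N -> R) (hnrm : is_vector_norm nrm)
    (p q : nat) (hp : (0 < p)%N) (hpq : (p < q)%N) (hcop : coprime p q)
    (delta : R) (hdelta : 0 < delta)
    (A B : nat -> nat -> 'M[R]_N) (Xi X : nat -> nat -> 'cV[R]_N)
    (hX : satisfies_recursion (p%:R / q%:R) A B Xi X)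
    (hXi : (0 < conv_radius (weighted_norm_sum nrm p q delta Xi))%E)
    (hL : (0 < conv_radius (antidiagonal_norm_sum nrm A))%E)
    (hM : (0 < conv_radius (antidiagonal_norm_sum nrm B))%E) :
  (0 < conv_radius (weighted_norm_sum nrm p q delta X))%E.
Proof.
have [K K0 XK] := weighted_recursion_le _ _ _ hnrm _ _ hp hpq _ _ _ _ _ hdelta hX.
have [C1 [r1 [C10 r10 XiC]]] := geometric_bound_of_radius _ _ hXi.
have [C2 [r2 [C20 r20 AC]]] := geometric_bound_of_radius _ _ hL.
have [C3 [r3 [C30 r30 BC]]] := geometric_bound_of_radius _ _ hM.
(* [discrete_gronwall] wants one pair of constants for forcing and kernel: [rho] dominates all three
   rates, and [C] dominates both [C1] and [K * (C2 + C3)]. *)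
pose rho := r1 + r2 + r3; pose C := C1 + K * (C2 + C3).
have rho0 : 0 < rho by rewrite !addr_gt0.
have C0 : 0 <= C by rewrite !(addr_ge0, mulr_ge0).
have r1rho : r1 <= rho by rewrite /rho; lra.
have r2rho : r2 <= rho by rewrite /rho; lra.
have r3rho : r3 <= rho by rewrite /rho; lra.
have rhoX r c n : 0 < r -> r <= rho -> 0 <= c -> c * r ^+ n <= c * rho ^+ n.
  by move=> r0 rrho c0; rewrite ler_wpM2l// lerXn2r// nnegrE ltW.
have W0 n : 0 <= weighted_norm_sum nrm p q delta X n by exact: weighted_norm_sum_ge0.
apply: (radius_gt0_of_geometric_bound _ _ C (rho * (1 + C))) => //.
  by rewrite mulr_gt0// ltr_wpDr.
pose k m := K * (antidiagonal_norm_sum nrm A m + antidiagonal_norm_sum nrm B m).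
apply: (discrete_gronwall _ _ _ k C rho C0 rho0 W0 _ _ XK) => n.
- apply: le_trans (XiC n) (le_trans (rhoX r1 C1 n r10 r1rho C10) _).
  by rewrite ler_wpM2r ?(exprn_ge0 _ (ltW rho0))// lerDl mulr_ge0 ?addr_ge0.
- apply: (@le_trans _ _ (K * (C2 * rho ^+ n + C3 * rho ^+ n))).
    rewrite ler_wpM2l// lerD//.
      by apply: le_trans (AC n) (rhoX r2 C2 n r20 r2rho C20).
    by apply: le_trans (BC n) (rhoX r3 C3 n r30 r3rho C30).
  by rewrite -mulrDl mulrA ler_wpM2r ?(exprn_ge0 _ (ltW rho0))// lerDr.
Qed.
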